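(* Let $n,m,M$ be positive integers, let $(A_i,B_i)\in\mathbb{R}^{n\times n}\times\mathbb{R}^{n\times m}$ for $i\in\langle M\rangle$, and let $\mathcal{G}=(S,E)$ be a complete graph on $\langle M\rangle$. There exist $\{P_s\}_{s\in S}\subset\mathbb{S}_+^{n\times n}$ and $\{K_s\}_{s\in S}\subset\mathbb{R}^{m\times n}$ such that $$(A_i+B_iK_a)^\top P_b(A_i+B_iK_a)-P_a\prec 0\qquad\text{for all } (a,b,i)\in E \tag{1}$$ if and only if there exist $\{\overline{P}_s\}_{s\in S}\subset\mathbb{S}^{n\times n}$ and $\{\overline{K}_s\}_{s\in S}\subset\mathbb{R}^{m\times n}$ such that $$\begin{bmatrix}\overline{P}_b & A_i\overline{P}_a+B_i\overline{K}_a\\ (A_i\overline{P}_a+B_i\overline{K}_a)^\top & \overline{P}_a\end{bmatrix}\succ 0\qquad\text{for all }(a,b,i)\in E. \tag{2}$$ Moreover, given $\{\overline{P}_s\}_{s\in S}$, $\{\overline{K}_s\}_{s\in S}$ satisfying (2), matrices $\{P_s\}_{s\in S}\subset\mathbb{S}_+^{n\times n}$, $\{K_s\}_{s\in S}\subset\mathbb{R}^{m\times n}$ satisfying (1) are given by $P_s=\overline{P}_s^{-1}$ and $K_s=\overline{K}_s\overline{P}_s^{-1}$ for every $s\in S$.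
   Context: Notation: $\langle M\rangle:=\{1,\dots,M\}$; $\mathbb{S}^{n\times n}$ is the set of symmetric real $n\times n$ matrices and $\mathbb{S}_+^{n\times n}$ the set of symmetric positive definite ones; $X\succ0$ (resp. $X\prec 0$) means positive (resp. negative) definite. Graphs: a (labeled, directed) graph $\mathcal{G}=(S,E)$ on $\langle M\rangle$ consists of a finite set of nodes $S$ and a set of labeled edges $E\subset S\times S\times\langle M\rangle$. It is complete if for all $a\in S$ and all $i\in\langle M\rangle$ there exists at least one $b\in S$ with $(a,b,i)\in E$. *)

(* Defs.v *)
From mathcomp Require Import all_boot all_order all_algebra.
From mathcomp Require Import reals.

Set Implicit Arguments.
Unset Strict Implicit.
Unset Printing Implicit Defensive.

Import Order.TTheory GRing.Theory Num.Theory.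
Local Open Scope ring_scope.

Lemma symmetricmxP (R : fieldType) (n : nat) (A : 'M[R]_n) :
  reflect (A^T = A) (A \is symmetricmx).
Proof.
rewrite qualifE /= expr0 scale1r map_mx_id //.
by apply: (iffP eqP) => [{2}->|->].
Qed.

Definition posdefmx (R : numFieldType) (n : nat) (A : 'M[R]_n) : Prop :=
  A \is symmetricmx /\ forall x : 'cV[R]_n, x != 0 -> 0 < (x^T *m A *m x) 0 0.

Definition negdefmx (R : numFieldType) (n : nat) (A : 'M[R]_n) : Prop :=
  A \is symmetricmx /\ forall x : 'cV[R]_n, x != 0 -> (x^T *m A *m x) 0 0 < 0.

(* The labels 1, ..., M are encoded as the elements 0, ..., M - 1 of 'I_M; an
   edge (a, b, i) goes from a to b and has label i. *)
Record lgraph (M : nat) := LGraph {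
  node : finType;
  edge : {set node * node * 'I_M}
}.

Definition complete_lgraph (M : nat) (G : lgraph M) : Prop :=
  forall (a : node G) (i : 'I_M), exists b : node G, (a, b, i) \in edge G.

Section Conditions.

Variables (R : numFieldType) (n m M : nat).
Variables (A : 'I_M -> 'M[R]_n) (B : 'I_M -> 'M[R]_(n, m)) (G : lgraph M).

Definition lyapunov_ineq (P : node G -> 'M[R]_n) (K : node G -> 'M[R]_(m, n))
    : Prop :=
  forall (a b : node G) (i : 'I_M), (a, b, i) \in edge G ->
    negdefmx ((A i + B i *m K a)^T *m P b *m (A i + B i *m K a) - P a).

Definition block_ineq (P : node G -> 'M[R]_n) (K : node G -> 'M[R]_(m, n))
    : Prop :=
  forall (a b : node G) (i : 'I_M), (a, b, i) \in edge G ->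
    posdefmx (block_mx (P b) (A i *m P a + B i *m K a)
                       (A i *m P a + B i *m K a)^T (P a)).

End Conditions.

(* Main.v *)
(* With [T = [P_b^-1, C P_a^-1; 0, P_a^-1]], an invertible matrix, the block
   matrix of (2) for [C = A_i + B_i K_a] is [T^T D T], where [D] is block
   diagonal with blocks [P_b] and [P_a - C^T P_b C]; hence it is positive
   definite iff both blocks are.  Completeness of the graph makes each
   [Pbar_s] a diagonal block of some matrix in (2), hence invertible. *)
Require Import Defs.
From mathcomp Require Import all_boot all_order all_algebra.
From mathcomp Require Import reals.

Set Implicit Arguments.
Unset Strict Implicit.
Unset Printing Implicit Defensive.

Import Order.TTheory GRing.Theory Num.Theory.
Local Open Scope ring_scope.

Lemma negdefmx_opp (R : numFieldType) (n : nat) (A : 'M[R]_n) :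
  negdefmx A <-> posdefmx (- A).
Proof.
split=> -[/symmetricmxP symA defA]; split.
- by apply/symmetricmxP; rewrite linearN /= symA.
- by move=> x /defA; rewrite -oppr_gt0 mulmxN mulNmx [in X in _ -> X]mxE.
- by apply/symmetricmxP/oppr_inj; rewrite -symA linearN.
- by move=> x /defA; rewrite mulmxN mulNmx mxE oppr_gt0.
Qed.

(** A nonzero row [v] with [v *m A = 0] would make the quadratic form vanish at [v^T], so the left
    kernel is trivial. *)
Lemma posdefmx_unit (R : numFieldType) (n : nat) (A : 'M[R]_n) :
  posdefmx A -> A \in unitmx.
Proof.
move=> [/symmetricmxP symA posA]; rewrite -row_free_unit -kermx_eq0.
apply/rowV0P => v /sub_kermxP vA0; apply/eqP/negPn/negP => v_neq0.
have vT_neq0 : v^T != 0 by rewrite trmx_eq0.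
by have := posA _ vT_neq0; rewrite trmxK vA0 mul0mx mxE ltxx.
Qed.

Lemma posdefmx_congr (R : numFieldType) (n : nat) (T A : 'M[R]_n) :
  T \in unitmx -> posdefmx A -> posdefmx (T^T *m A *m T).
Proof.
move=> unitT [/symmetricmxP symA posA]; split.
  by apply/symmetricmxP; rewrite !trmx_mul trmxK symA mulmxA.
move=> x x_neq0.
have Tx_neq0 : T *m x != 0.
  by apply: contra_neq x_neq0 => Tx0; rewrite -(mulKmx unitT x) Tx0 mulmx0.
by have := posA _ Tx_neq0; rewrite trmx_mul !mulmxA.
Qed.

Lemma posdefmx_congrE (R : numFieldType) (n : nat) (T A : 'M[R]_n) :
  T \in unitmx -> posdefmx (T^T *m A *m T) <-> posdefmx A.
Proof.
move=> unitT; split; last exact: posdefmx_congr.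
have unitTV : invmx T \in unitmx by rewrite unitmx_inv.
move=> /(posdefmx_congr unitTV).
by rewrite trmx_inv !mulmxA mulVmx ?unitmx_tr // mul1mx mulmxK.
Qed.

(** By symmetry, [A^T *m invmx A *m A = A], so [A] is congruent to its own inverse. *)
Lemma posdefmx_inv (R : numFieldType) (n : nat) (A : 'M[R]_n) :
  posdefmx A -> posdefmx (invmx A).
Proof.
move=> posA; have unitA := posdefmx_unit posA.
have symA : A^T = A by case: posA => /symmetricmxP.
by rewrite -(posdefmx_congrE _ unitA) symA mulmxV // mul1mx.
Qed.

(** Evaluate the large quadratic form at vectors whose upper part is zero. *)
Lemma posdefmx_block_drsub (R : numFieldType) (n p : nat)
    (A : 'M[R]_n) (U : 'M[R]_(n, p)) (L : 'M[R]_(p, n)) (D : 'M[R]_p) :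
  posdefmx (block_mx A U L D) -> posdefmx D.
Proof.
move=> [/symmetricmxP symX posX]; split.
  apply/symmetricmxP; move: symX; rewrite tr_block_mx.
  by case/eq_block_mx.
move=> y y_neq0; have y0_neq0 : col_mx (0 : 'cV[R]_n) y != 0.
  by rewrite col_mx_eq0 negb_and y_neq0 orbT.
have := posX _ y0_neq0.
rewrite tr_col_mx mul_row_block mul_row_col.
by rewrite trmx0 !mul0mx !mulmx0 !add0r.
Qed.

Lemma posdefmx_block_diag (R : numFieldType) (n p : nat)
    (A : 'M[R]_n) (D : 'M[R]_p) :
  posdefmx A -> posdefmx D -> posdefmx (block_mx A 0 0 D).
Proof.
move=> [/symmetricmxP symA posA] [/symmetricmxP symD posD]; split.
  by apply/symmetricmxP; rewrite tr_block_mx symA symD !trmx0.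
move=> x; rewrite -[x]vsubmxK.
move: (usubmx x) (dsubmx x) => {x} u v uv_neq0.
rewrite tr_col_mx mul_row_block mul_row_col !mulmx0 addr0 add0r mxE.
(* Only one of [u], [v] is known to be nonzero, and strict positivity is available only at nonzero
   vectors, hence the case split. *)
have [u0|u_neq0] := eqVneq u 0.
  move: uv_neq0; rewrite u0 col_mx_eq0 eqxx /= => /posD v_gt0.
  by rewrite mulmx0 [X in X + _]mxE add0r.
have [->|/posD v_gt0] := eqVneq v 0.
  by rewrite mulmx0 [X in _ + X]mxE addr0 posA.
by rewrite addr_gt0 ?posA.
Qed.

Lemma schur_posdefmx (R : numFieldType) (n : nat) (P Q C : 'M[R]_n) :
  posdefmx P -> posdefmx Q ->
  posdefmx (block_mx (invmx Q) (C *m invmx P) (C *m invmx P)^T (invmx P))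
  <-> negdefmx (C^T *m Q *m C - P).
Proof.
move=> posP posQ; have unitP := posdefmx_unit posP.
have unitQ := posdefmx_unit posQ.
have symPV : (invmx P)^T = invmx P.
  by case: (posdefmx_inv posP) => /symmetricmxP.
have symQV : (invmx Q)^T = invmx Q.
  by case: (posdefmx_inv posQ) => /symmetricmxP.
pose T := block_mx (invmx Q) (C *m invmx P) 0 (invmx P).
have unitT : T \in unitmx.
  by rewrite unitmxE det_ublock unitrM -!unitmxE !unitmx_inv unitP unitQ.
have -> : block_mx (invmx Q) (C *m invmx P) (C *m invmx P)^T (invmx P) =
          T^T *m block_mx Q 0 0 (P - C^T *m Q *m C) *m T.
  rewrite tr_block_mx trmx0 !mulmx_block !mulmx0 !mul0mx !addr0 !add0r.
  rewrite symPV symQV trmx_mul symPV mulVmx // !mul1mx.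
  rewrite mulmxK // mulmxBr mulmxBl mulVmx // mul1mx !mulmxA.
  (* In the lower right block, the two copies of [invmx P *m C^T *m Q *m C *m invmx P] cancel,
     leaving [invmx P]. *)
  by rewrite mul0mx addr0 addrC subrK.
rewrite (posdefmx_congrE _ unitT) negdefmx_opp opprB.
(* The upper block [Q] is positive definite by hypothesis, so only the lower block is at stake. *)
by split=> [/posdefmx_block_drsub|]; last exact: posdefmx_block_diag.
Qed.

Theorem lemma1 (R : realType) (n m M : nat)
    (n_gt0 : (0 < n)%N) (m_gt0 : (0 < m)%N) (M_gt0 : (0 < M)%N)
    (A : 'I_M -> 'M[R]_n) (B : 'I_M -> 'M[R]_(n, m))
    (G : lgraph M) (complG : complete_lgraph G) :
  ((exists (P : node G -> 'M[R]_n) (K : node G -> 'M[R]_(m, n)),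
      (forall s, posdefmx (P s)) /\ lyapunov_ineq A B P K)
   <->
   (exists (Pbar : node G -> 'M[R]_n) (Kbar : node G -> 'M[R]_(m, n)),
      (forall s, Pbar s \is symmetricmx) /\ block_ineq A B Pbar Kbar))
  /\
  (forall (Pbar : node G -> 'M[R]_n) (Kbar : node G -> 'M[R]_(m, n)),
     (forall s, Pbar s \is symmetricmx) -> block_ineq A B Pbar Kbar ->
     [/\ forall s, Pbar s \in unitmx,
         forall s, posdefmx (invmx (Pbar s)) &
         lyapunov_ineq A B (fun s => invmx (Pbar s))
                           (fun s => Kbar s *m invmx (Pbar s))]).
Proof.
(* The explicit formulas come first: they also supply the witnesses for the implication from (2) to
   (1). *)
have block_lyapunov (Pbar : node G -> 'M[R]_n) (Kbar : node G -> 'M[R]_(m, n)) :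
    block_ineq A B Pbar Kbar ->
    [/\ forall s, Pbar s \in unitmx,
        forall s, posdefmx (invmx (Pbar s)) &
        lyapunov_ineq A B (fun s => invmx (Pbar s))
                          (fun s => Kbar s *m invmx (Pbar s))].
  move=> blockP.
  have posP s : posdefmx (Pbar s).
    (* Since [M > 0], there is a label 0; an edge with this label leaves [s], and its source matrix
       [Pbar s] is the lower right block in (2). *)
    have [b sb] := complG s (Ordinal M_gt0).
    exact: posdefmx_block_drsub (blockP _ _ _ sb).
  have posPV s : posdefmx (invmx (Pbar s)) := posdefmx_inv (posP s).
  split=> // [s|a b i abi]; first exact: posdefmx_unit.
  (* Here [C] is [A i + B i *m (Kbar a *m invmx (Pbar a))], and multiplying it by [Pbar a] gives
     [A i *m Pbar a + B i *m Kbar a]. *)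
  apply/schur_posdefmx => //; rewrite !invmxK mulmxDl.
  by rewrite !mulmxA mulmxKV ?posdefmx_unit //; apply: blockP.
split; last by move=> Pbar Kbar _; apply: block_lyapunov.
split=> [[P [K [posP lyapP]]]|[Pbar [Kbar [_ /block_lyapunov[_ posPV lyapP]]]]].
  (* This change of variables turns the off-diagonal block into [(A i + B i *m K a) *m invmx (P a)],
     linear in the new unknowns. *)
  exists (fun s => invmx (P s)), (fun s => K s *m invmx (P s)).
  split=> [s|a b i abi]; first by case: (posdefmx_inv (posP s)).
  rewrite mulmxA -mulmxDl; apply/schur_posdefmx => //; exact: lyapP.
by exists (fun s => invmx (Pbar s)), (fun s => Kbar s *m invmx (Pbar s)).
Qed.
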